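(* Let $(Y,\gamma)$ be a GTspace. Then the following are equivalent. (1) $(Y,\gamma)$ is $s\lambda$-normal. (2) For each $s\lambda$-closed set $P$ and each $s\lambda$-open set $G$ containing $P$, there exists an $sg_\lambda$-open set $E$ such that $P\subset E\subset\mathrm{cl}_{s\lambda}(E)\subset G$. (3) For each $s\lambda$-closed set $P$ and each $sg_\lambda$-open set $G$ containing $P$, there exists an $sg_\lambda$-open set $E$ such that $P\subset E\subset\mathrm{cl}_{s\lambda}(E)\subset \mathrm{sInt}_\lambda(G)$. (4) For each $sg_\lambda$-closed set $P$ and each $s\lambda$-open set $G$ containing $P$, there exists an $s\lambda$-open set $E$ such that $\mathrm{cl}_{s\lambda}(P)\subset E\subset\mathrm{cl}_{s\lambda}(E)\subset G$. (5) For each $s\lambda$-closed set $P$ and each $sg_\lambda$-open set $G$ containing $P$, there exists an $s\lambda$-open set $E$ such that $P\subset E\subset\mathrm{cl}_{s\lambda}(E)\subset \mathrm{sInt}_\lambda(G)$. (6) For each $sg_\lambda$-closed set $P$ and each $s\lambda$-open set $G$ containing $P$, there exists an $sg_\lambda$-open set $E$ such that $\mathrm{cl}_{s\lambda}(P)\subset E\subset\mathrm{cl}_{s\lambda}(E)\subset G$.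
   Context: A generalized topology on a nonempty set $Y$ is a collection $\gamma$ of subsets of $Y$ with $\emptyset\in\gamma$ that is closed under arbitrary unions; $(Y,\gamma)$ is then called a GTspace (it is not required that $Y\in\gamma$, nor closure under finite intersections). Members of $\gamma$ are called $\gamma$-open and their complements $\gamma$-closed; the $\gamma$-closure $\overline{D}_\gamma$ of $D\subset Y$ is the intersection of all $\gamma$-closed sets containing $D$. A set $D\subset Y$ is $s\gamma$-open if there is a $\gamma$-open set $V$ with $V\subset D\subset\overline{V}_\gamma$; $D$ is $s\gamma$-closed if $Y-D$ is $s\gamma$-open. $\mathrm{sker}_\gamma(D)$ is the intersection of all $s\gamma$-open sets containing $D$. A set $D\subset Y$ is $s\lambda$-closed if $D=M\cap N$ for some $M$ with $M=\mathrm{sker}_\gamma(M)$ and some $s\gamma$-closed set $N$; $D$ is $s\lambda$-open if $Y-D$ is $s\lambda$-closed. The $s\lambda$-closure $\mathrm{cl}_{s\lambda}(D)$ is the set of all $y\in Y$ such that every $s\lambda$-open set containing $y$ meets $D$. The $s\lambda$-interior $\mathrm{sInt}_\lambda(D)$ is the union of all $s\lambda$-open sets contained in $D$. A set $D\subset Y$ is $sg_\lambda$-closed if $\mathrm{cl}_{s\lambda}(D)\subset V$ whenever $D\subset V$ and $V$ is $s\lambda$-open; $D$ is $sg_\lambda$-open if $Y-D$ is $sg_\lambda$-closed. $(Y,\gamma)$ is $s\lambda$-normal if for any pair of disjoint $s\lambda$-closed sets $A,B$ there exist $s\lambda$-open sets $E,F$ with $A\subset E$, $B\subset F$ and $\mathrm{cl}_{s\lambda}(E)\cap\mathrm{cl}_{s\lambda}(F)=\emptyset$.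 *)

(* Defs.v *)
From mathcomp Require Import all_boot.
From mathcomp Require Import boolp classical_sets.

Set Implicit Arguments.
Unset Strict Implicit.
Unset Printing Implicit Defensive.

Local Open Scope classical_set_scope.

(* [setT] need not belong to [gamma], and [gamma] need not be closed under
   finite intersections. *)
Record GTspace (Y : Type) (gamma : set (set Y)) : Prop := {
  GTspace_nonempty : [set: Y] !=set0;
  GTspace_set0 : gamma set0;
  GTspace_bigcup : forall G : set (set Y),
    G `<=` gamma -> gamma (\bigcup_(A in G) A)
}.

Section GeneralizedTopology.
Variables (Y : Type) (gamma : set (set Y)).
Implicit Types D E F G M N P V : set Y.

Definition g_open D : Prop := gamma D.

Definition g_closed D : Prop := g_open (~` D).

Definition g_closure D : set Y :=
  \bigcap_(C in [set C | g_closed C /\ D `<=` C]) C.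

Definition s_open D : Prop :=
  exists V, [/\ g_open V, V `<=` D & D `<=` g_closure V].

Definition s_closed D : Prop := s_open (~` D).

Definition sker D : set Y :=
  \bigcap_(U in [set U | s_open U /\ D `<=` U]) U.

Definition sl_closed D : Prop :=
  exists M N, [/\ M = sker M, s_closed N & D = M `&` N].

Definition sl_open D : Prop := sl_closed (~` D).

Definition sl_closure D : set Y :=
  [set y | forall U, sl_open U -> U y -> U `&` D !=set0].

Definition sl_interior D : set Y :=
  \bigcup_(U in [set U | sl_open U /\ U `<=` D]) U.

Definition sgl_closed D : Prop :=
  forall V, sl_open V -> D `<=` V -> sl_closure D `<=` V.

Definition sgl_open D : Prop := sgl_closed (~` D).

Definition sl_normal : Prop :=
  forall A B, sl_closed A -> sl_closed B -> A `&` B = set0 ->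
  exists E F, [/\ sl_open E, sl_open F, A `<=` E, B `<=` F &
                  sl_closure E `&` sl_closure F = set0].

End GeneralizedTopology.

(* Main.v *)
Require Import Defs.
From mathcomp Require Import all_boot.
From mathcomp Require Import boolp classical_sets.

(** The [sl_closed] sets are stable under arbitrary intersections
([sl_closed_bigcap]).  Hence [sl_closure D] is the least [sl_closed] set
containing [D], and [sl_interior] is its dual under complement.

All six conditions are compared with one shrinking property
([sl_shrinking]): between an [sl_closed] set and an [sl_open] set containing
it one can insert an [sl_open] set together with its closure.

- Shrinking is normality read through complements.  Disjoint closures, rather
  than merely disjoint neighbourhoods, come from shrinking twice
  ([sl_normal_shrinking]).
- Generalized open and closed sets reduce to ordinary ones.  If [G] is
  [sgl_open] and contains an [sl_closed] set [P], then already
  [sl_interior G] contains [P] ([sgl_open_interior]); if [P] is [sgl_closed] and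
  lies in an [sl_open] set, so does [sl_closure P].  So an [sgl_open]
  interpolant can be replaced by its interior
  ([sl_shrinking_of_sgl_open]), and each condition both implies shrinking and
  follows from it. *)

Local Open Scope classical_set_scope.

Section GeneralizedTopology.
Set Implicit Arguments.
Unset Strict Implicit.
Variables (Y : Type) (gamma : set (set Y)).
Hypothesis hY : GTspace gamma.
Implicit Types (D E G M N P U V : set Y) (F : set (set Y)).

Lemma g_closure_mono D E : D `<=` E -> g_closure gamma D `<=` g_closure gamma E.
Proof.
by move=> DE y Dy C [cC EC]; apply: Dy; split=> //; exact: subset_trans EC.
Qed.

Lemma s_open_bigcup F :
  F `<=` s_open gamma -> s_open gamma (\bigcup_(D in F) D).
Proof.
move=> oF.
(* The largest open subset of the union contains the open witness of every
   member of F at once, so none of these witnesses has to be chosen. *)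
exists (\bigcup_(V in [set V | g_open gamma V /\ V `<=` \bigcup_(D in F) D]) V).
split.
- by apply: (GTspace_bigcup hY) => V [].
- by move=> y [V [_ VF]] /VF.
- move=> y [D FD Dy]; have [V [oV VD DV]] := oF _ FD.
  apply: g_closure_mono (DV _ Dy) => z Vz.
  by exists V => //; split=> // w /VD Dw; exists D.
Qed.

Lemma s_closed_bigcap F :
  F `<=` s_closed gamma -> s_closed gamma (\bigcap_(D in F) D).
Proof.
move=> cF; rewrite /s_closed setC_bigcap.
have -> : \bigcup_(D in F) ~` D = \bigcup_(U in [set ~` D | D in F]) U.
  by rewrite bigcup_image.
by apply: s_open_bigcup => _ [D FD <-]; exact: cF.
Qed.

Lemma sub_sker D : D `<=` sker gamma D.
Proof. by move=> y Dy U [_]; exact. Qed.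

Lemma sker_mono D E : D `<=` E -> sker gamma D `<=` sker gamma E.
Proof.
by move=> DE y Dy U [oU EU]; apply: Dy; split=> //; exact: subset_trans EU.
Qed.

Lemma sker_idem D : sker gamma (sker gamma D) = sker gamma D.
Proof.
rewrite eqEsubset; split; last exact: sub_sker.
by move=> y kDy U [oU DU]; apply: kDy; split=> // z; apply.
Qed.

(** For any set [X], the pair made of the kernel of [X] and the least
[s_closed] set containing [X] lies below every pair [(M, N)] of the defining
form with [X `<=` M `&` N].  For [X] the intersection of [F], this one pair is
therefore below the decomposition of each member, and it cuts out exactly [X]. *)
Lemma sl_closed_bigcap F :
  F `<=` sl_closed gamma -> sl_closed gamma (\bigcap_(D in F) D).
Proof.
move=> cF; set X := \bigcap_(D in F) D.
exists (sker gamma X), (\bigcap_(N in [set N | s_closed gamma N /\ X `<=` N]) N).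
split; first by rewrite sker_idem.
  by apply: s_closed_bigcap => N [].
rewrite eqEsubset; split=> [y Xy|y [kXy cXy] D FD].
  by split; [exact: sub_sker|move=> N [_]; exact].
have [M [N [kM cN DMN]]] := cF _ FD.
have XMN : X `<=` M `&` N by rewrite -DMN => z; exact.
rewrite DMN; split.
  by rewrite kM; apply: sker_mono kXy => z /XMN[].
by apply: cXy; split=> // z /XMN[].
Qed.

Lemma sl_openC D : sl_open gamma (~` D) = sl_closed gamma D.
Proof. by rewrite /sl_open setCK. Qed.

Lemma sub_sl_closure D : D `<=` sl_closure gamma D.
Proof. by move=> y Dy U _ Uy; exists y. Qed.

Lemma sl_closure_mono D E :
  D `<=` E -> sl_closure gamma D `<=` sl_closure gamma E.
Proof.
by move=> DE y cDy U oU Uy; have [z [Uz /DE Ez]] := cDy U oU Uy; exists z.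
Qed.

Lemma sl_closure_min D P :
  sl_closed gamma P -> D `<=` P -> sl_closure gamma D `<=` P.
Proof.
move=> cP DP y cDy; apply: contrapT => nPy.
by have [|z [nPz /DP]] := cDy (~` P) _ nPy; first by rewrite sl_openC.
Qed.

Lemma sl_closure_closed D : sl_closed gamma (sl_closure gamma D).
Proof.
have -> : sl_closure gamma D =
    \bigcap_(P in [set P | sl_closed gamma P /\ D `<=` P]) P.
  rewrite eqEsubset; split=> y.
    by move=> cDy P [cP DP]; exact: (sl_closure_min cP DP).
  move=> cDy U oU Uy; apply: contrapT => UD0.
  have /cDy : [set P | sl_closed gamma P /\ D `<=` P] (~` U).
    by split=> // z Dz Uz; apply: UD0; exists z.
  exact.
by apply: sl_closed_bigcap => P [].
Qed.

Lemma sl_closure_id P : sl_closed gamma P -> sl_closure gamma P = P.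
Proof.
move=> cP; rewrite eqEsubset; split; last exact: sub_sl_closure.
exact: sl_closure_min.
Qed.

Lemma sl_interior_sub D : sl_interior gamma D `<=` D.
Proof. by move=> y [U [_ UD]] /UD. Qed.

Lemma sl_interiorE D : sl_interior gamma D = ~` sl_closure gamma (~` D).
Proof.
rewrite eqEsubset; split=> [y [U [oU UD] Uy] cy|y ncy].
  by have [z [/UD Dz]] := cy U oU Uy; exact.
exists (~` sl_closure gamma (~` D)) => //; split.
  by rewrite /= sl_openC; exact: sl_closure_closed.
by rewrite -[X in _ `<=` X]setCK; apply: subsetC; exact: sub_sl_closure.
Qed.

Lemma sl_interior_open D : sl_open gamma (sl_interior gamma D).
Proof. by rewrite sl_interiorE sl_openC; exact: sl_closure_closed. Qed.

Lemma sl_open_sgl_open D : sl_open gamma D -> sgl_open gamma D.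
Proof. by move=> oD V _; rewrite sl_closure_id. Qed.

Lemma sl_closed_sgl_closed D : sl_closed gamma D -> sgl_closed gamma D.
Proof. by move=> cD V _; rewrite sl_closure_id. Qed.

(** Complement form of the definition of [sgl_closed]: [~` P] is one of the
[sl_open] sets containing [~` G]. *)
Lemma sgl_open_interior P G : sl_closed gamma P -> sgl_open gamma G ->
  P `<=` G -> P `<=` sl_interior gamma G.
Proof.
move=> cP oG PG; rewrite sl_interiorE -[P]setCK; apply: subsetC.
by apply: oG; [rewrite sl_openC|exact: subsetC].
Qed.

(** The analogue, for [sl_open] and [sl_closed] sets, of the shrinking
characterization of normal topological spaces. *)
Definition sl_shrinking : Prop :=
  forall P G, sl_closed gamma P -> sl_open gamma G -> P `<=` G ->
  exists E, [/\ sl_open gamma E, P `<=` E & sl_closure gamma E `<=` G].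

Lemma sl_normal_shrinking : sl_normal gamma <-> sl_shrinking.
Proof.
split=> [nY P G cP oG PG|shr A B cA cB AB0].
  have [|E [F [oE oF PE GF EF0]]] := nY P (~` G) cP oG.
    by apply/disjoints_subset; rewrite setCK.
  exists E; split=> // y cEy; apply: contrapT => /GF Fy.
  have : (sl_closure gamma E `&` sl_closure gamma F) y.
    by split=> //; exact: sub_sl_closure.
  by rewrite EF0.
have oB : sl_open gamma (~` B) by rewrite sl_openC.
have [E [oE AE EB]] := shr A (~` B) cA oB ((disjoints_subset A B).1 AB0).
(* Shrinking again around the closure of E gives an open H: the complement of
   the closure of H is an open set containing B, and its closure stays in the
   closed set ~` H, which misses the closure of E. *)
have [H [oH EH HB]] := shr _ _ (sl_closure_closed E) oB EB.
exists E, (~` sl_closure gamma H); split=> //.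
- by rewrite sl_openC; exact: sl_closure_closed.
- by rewrite -[B]setCK; exact: subsetC.
apply/disjoints_subset; apply: (subset_trans EH).
rewrite -[H in H `<=` _]setCK; apply: subsetC.
by apply: sl_closure_min => //; apply: subsetC; exact: sub_sl_closure.
Qed.

(** The interior of an [sgl_open] interpolant is an [sl_open] one. *)
Lemma sl_shrinking_of_sgl_open :
  (forall P G, sl_closed gamma P -> sl_open gamma G -> P `<=` G ->
   exists E, [/\ sgl_open gamma E, P `<=` E & sl_closure gamma E `<=` G]) ->
  sl_shrinking.
Proof.
move=> sep P G cP oG PG; have [E [oE PE EG]] := sep P G cP oG PG.
exists (sl_interior gamma E); split.
- exact: sl_interior_open.
- exact: sgl_open_interior.
- exact: subset_trans (sl_closure_mono (@sl_interior_sub E)) EG.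
Qed.

Lemma sl_shrinking_interior : sl_shrinking ->
  forall P G, sl_closed gamma P -> sgl_open gamma G -> P `<=` G ->
  exists E, [/\ sl_open gamma E, P `<=` E &
    sl_closure gamma E `<=` sl_interior gamma G].
Proof.
move=> shr P G cP oG PG; apply: shr => //; first exact: sl_interior_open.
exact: sgl_open_interior.
Qed.

End GeneralizedTopology.

Theorem theorem3p13 (Y : Type) (gamma : set (set Y)) (hY : GTspace gamma) :
  [<-> sl_normal gamma;
       (forall P G : set Y, sl_closed gamma P -> sl_open gamma G -> P `<=` G ->
        exists E : set Y, [/\ sgl_open gamma E, P `<=` E,
          E `<=` sl_closure gamma E & sl_closure gamma E `<=` G]);
       (forall P G : set Y, sl_closed gamma P -> sgl_open gamma G -> P `<=` G ->
        exists E : set Y, [/\ sgl_open gamma E, P `<=` E,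
          E `<=` sl_closure gamma E &
          sl_closure gamma E `<=` sl_interior gamma G]);
       (forall P G : set Y, sgl_closed gamma P -> sl_open gamma G -> P `<=` G ->
        exists E : set Y, [/\ sl_open gamma E, sl_closure gamma P `<=` E,
          E `<=` sl_closure gamma E & sl_closure gamma E `<=` G]);
       (forall P G : set Y, sl_closed gamma P -> sgl_open gamma G -> P `<=` G ->
        exists E : set Y, [/\ sl_open gamma E, P `<=` E,
          E `<=` sl_closure gamma E &
          sl_closure gamma E `<=` sl_interior gamma G]);
       (forall P G : set Y, sgl_closed gamma P -> sl_open gamma G -> P `<=` G ->
        exists E : set Y, [/\ sgl_open gamma E, sl_closure gamma P `<=` E,
          E `<=` sl_closure gamma E & sl_closure gamma E `<=` G])].
Proof.
tfae.
- move=> /(sl_normal_shrinking hY) shr P G cP oG PG.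
  have [E [oE PE EG]] := shr P G cP oG PG.
  exists E; split=> //; first exact: sl_open_sgl_open.
  exact: sub_sl_closure.
- move=> sep P G cP oG PG.
  have shr : sl_shrinking gamma.
    apply: (sl_shrinking_of_sgl_open hY) => Q H cQ oH QH.
    by have [E [oE QE _ EH]] := sep Q H cQ oH QH; exists E.
  have [E [oE PE EG]] := sl_shrinking_interior hY shr cP oG PG.
  exists E; split=> //; first exact: sl_open_sgl_open.
  exact: sub_sl_closure.
- move=> sep P G cP oG PG.
  have shr : sl_shrinking gamma.
    apply: (sl_shrinking_of_sgl_open hY) => Q H cQ oH QH.
    have [E [oE QE _ EH]] := sep Q H cQ (sl_open_sgl_open oH) QH.
    by exists E; split=> //; apply: subset_trans EH (@sl_interior_sub _ _ H).
  have [E [oE PE EG]] := shr _ G (sl_closure_closed hY P) oG (cP G oG PG).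
  by exists E; split=> //; exact: sub_sl_closure.
- move=> sep P G cP oG PG.
  have shr : sl_shrinking gamma.
    move=> Q H cQ oH QH.
    have [E [oE QE _ EH]] := sep Q H (sl_closed_sgl_closed cQ) oH QH.
    by exists E; split=> //; apply: subset_trans QE; exact: sub_sl_closure.
  have [E [oE PE EG]] := sl_shrinking_interior hY shr cP oG PG.
  by exists E; split=> //; exact: sub_sl_closure.
- move=> sep P G cP oG PG.
  have [E [oE PE EE EG]] := sep _ G (sl_closure_closed hY P)
    (sl_open_sgl_open oG) (cP G oG PG).
  exists E; split=> //; first exact: sl_open_sgl_open.
  exact: subset_trans EG (@sl_interior_sub _ _ G).
- move=> sep; apply/(sl_normal_shrinking hY).
  apply: (sl_shrinking_of_sgl_open hY) => P G cP oG PG.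
  have [E [oE PE _ EG]] := sep P G (sl_closed_sgl_closed cP) oG PG.
  by exists E; split=> //; apply: subset_trans PE; exact: sub_sl_closure.
Qed.
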